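(* Let $k\geq 3$ be an integer. There is a Borel $3(k-1)^2$-regular graph $G_k$ on a Polish space such that all the connected components of $G_k$ have two ends, $\chi(G_k)=k$, and $\chi_{BM}(G_k)=\chi_B(G_k)=2k-1$.
   Context: A graph on a set $X$ is a symmetric irreflexive relation $G \subset X \times X$; vertices $x,y$ are adjacent if $(x,y)\in G$. $G$ is $d$-regular if every vertex is adjacent to exactly $d$ other vertices. A connected component of $G$ is an equivalence class of the equivalence relation on $X$ generated by $G$. For $A\subset X$, $G \upharpoonright A$ denotes the graph $G\cap (A\times A)$ on $A$. Ends: for a connected locally finite graph $G$ on a set $X$, a subset $F\subset X$ divides $G$ into $n$ parts if $G\upharpoonright (X-F)$ has exactly $n$ infinite connected components. $G$ has $n$ ends if there is a finite set $F$ dividing $G$ into $n$ parts, but no finite $F$ dividing $G$ into $m$ parts for any $m>n$. A connected component $C$ of a graph $G$ has two ends if the connected graph $G\upharpoonright C$ does. A (proper) coloring of $G$ is a function $c:X\to Y$ with $c(x)\neq c(y)$ whenever $x,y$ are adjacent; it is a $k$-coloring if $|Y|=k$. The chromatic number $\chi(G)$ is the least $k$ such that $G$ admits a $k$-coloring. When $X$ is a Polish space, $G$ is Borel if it is a Borel subset of $X\times X$. A coloring $c:X\to Y$ with $Y$ Polish is Borel (resp. Baire measurable) if $c$ is a Borel (resp. Baire measurable) function. The Borel chromatic number $\chi_B(G)$ (resp. Baire measurable chromatic number $\chi_{BM}(G)$) is the least $k$ such that $G$ admits a Borel (resp. Baire measurable) $k$-coloring. *)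

(* Defs.v *)
From Stdlib Require Import Relation_Operators.
From mathcomp Require Import all_boot all_order all_algebra.
From mathcomp Require Import all_classical all_reals topology measure.

Set Implicit Arguments.
Unset Strict Implicit.
Unset Printing Implicit Defensive.

Local Open Scope classical_set_scope.
Local Open Scope card_scope.

Section Polish.
Local Open Scope ring_scope.
Variables (R : realType) (T : topologicalType).

Definition is_metric (d : T -> T -> R) : Prop :=
  [/\ forall x y, 0 <= d x y,
      forall x y, d x y = 0 <-> x = y,
      forall x y, d x y = d y x &
      forall x y z, d x z <= d x y + d y z].

Definition metric_compatible (d : T -> T -> R) : Prop :=
  forall (x : T) (A : set T),
    nbhs x A <-> exists2 e : R, 0 < e & [set y | d x y < e] `<=` A.

Definition metric_cauchy (d : T -> T -> R) (u : nat -> T) : Prop :=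
  forall e : R, 0 < e ->
    exists N : nat, forall m n, (N <= m)%N -> (N <= n)%N -> d (u m) (u n) < e.

Definition metric_complete (d : T -> T -> R) : Prop :=
  forall u : nat -> T, metric_cauchy d u -> exists l : T, u @ \oo --> l.

Definition separable : Prop := exists2 D : set T, countable D & dense D.

Definition polish : Prop :=
  separable /\
  exists d : T -> T -> R,
    [/\ is_metric d, metric_compatible d & metric_complete d].

End Polish.

Section BorelBaire.

Definition borel (T : topologicalType) (A : set T) : Prop := <<s open >> A.

Definition borel_fun (T U : topologicalType) (f : T -> U) : Prop :=
  forall B : set U, borel B -> borel (f @^-1` B).

Definition nowhere_dense (T : topologicalType) (A : set T) : Prop :=
  interior (closure A) = set0.

Definition meager (T : topologicalType) (A : set T) : Prop :=
  exists2 F : nat -> set T,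
    (forall n, nowhere_dense (F n)) & A = \bigcup_n F n.

Definition baire_property (T : topologicalType) (A : set T) : Prop :=
  exists2 U : set T, open U & meager ((A `\` U) `|` (U `\` A)).

Definition baire_measurable_fun (T U : topologicalType) (f : T -> U) : Prop :=
  forall V : set U, open V -> baire_property (f @^-1` V).

End BorelBaire.

Section Graphs.
Variable X : Type.
Implicit Types (A C F : set X) (G : set (X * X)).

Definition is_graph G : Prop :=
  (forall x y, G (x, y) -> G (y, x)) /\ (forall x, ~ G (x, x)).

Definition regular (d : nat) G : Prop :=
  forall x, [set y | G (x, y)] #= `I_d.

(* A graph on A is kept as a set of pairs of X that is contained in A `*` A. *)
Definition induced G A : set (X * X) := G `&` (A `*` A).

Definition class_of G (x : X) : set X :=
  [set y | clos_refl_sym_trans X (fun u v => G (u, v)) x y].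

(* Connected components of a graph G on A.  Points outside A are isolated in G,
   so the class of a point of A does not leave A. *)
Definition components A G : set (set X) := class_of G @` A.

Definition divides A G F (n : nat) : Prop :=
  [set C | components (A `\` F) (induced G (A `\` F)) C /\ infinite_set C]
    #= `I_n.

Definition has_ends A G (n : nat) : Prop :=
  (exists F, [/\ F `<=` A, finite_set F & divides A G F n]) /\
  (forall F m, F `<=` A -> finite_set F -> (n < m)%N -> ~ divides A G F m).

Definition component_has_ends G C (n : nat) : Prop :=
  has_ends C (induced G C) n.

Definition coloring (Y : Type) G (c : X -> Y) : Prop :=
  forall x y, G (x, y) -> c x <> c y.

Definition colorable G (n : nat) : Prop :=
  exists Y : Type, [set: Y] #= `I_n /\ exists c : X -> Y, coloring G c.

Definition is_least (P : nat -> Prop) (n : nat) : Prop :=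
  P n /\ forall m, P m -> (n <= m)%N.

Definition chromatic_number G (n : nat) : Prop := is_least (colorable G) n.

End Graphs.

Section MeasurableColorings.
Variables (R : realType) (X : topologicalType).
Implicit Types G : set (X * X).

Definition borel_colorable G (n : nat) : Prop :=
  exists Y : topologicalType,
    [/\ polish R Y, [set: Y] #= `I_n &
        exists c : X -> Y, coloring G c /\ borel_fun c].

Definition baire_colorable G (n : nat) : Prop :=
  exists Y : topologicalType,
    [/\ polish R Y, [set: Y] #= `I_n &
        exists c : X -> Y, coloring G c /\ baire_measurable_fun c].

Definition borel_chromatic_number G (n : nat) : Prop :=
  is_least (borel_colorable G) n.

Definition baire_chromatic_number G (n : nat) : Prop :=
  is_least (baire_colorable G) n.

End MeasurableColorings.

(* Main.v *)
Require Import Defs.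
From HB Require Import structures.
From Stdlib Require Import Relation_Operators.
From mathcomp Require Import all_boot all_order all_algebra.
From mathcomp Require Import all_classical all_reals topology measure.
From mathcomp Require Import zify.

(** The vertex set is a bundle of k x k grids over the compact group of all
    sequences x with x n in Z / 3 ^ n.+1, on which Z acts freely by adding an
    integer to every coordinate.  Two grid cells are far when they differ in
    both coordinates; far is the edge relation of the tensor square of the
    clique K_k, and it is regular of degree (k - 1) ^ 2.  A point (x, p) is
    adjacent to the points over x - 1, x and x + 1 whose cell is far from p,
    except that the grid is transposed whenever the base point moves by one.

    Along a single orbit the transpositions can be undone ([act]), and the
    component becomes Z x grid, where adjacency means: layers at distance at
    most one and far cells.  This graph has two ends, since any two cells have
    a common far cell ([thread_two_ends]); it is colored with k colors by the
    row of the cell and it contains the diagonal k-clique.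

    With fewer than 2k - 1 colors the coloring of a layer has one of two
    types: each row repeats a color, or each column does.  Indeed a row and a
    column without repetition together show 2k - 1 colors
    ([repeat_dichotomy]).  Adjacent layers, after untwisting, have the same
    type, since a row-repeating layer next to a column-repeating one needs 2k
    colors ([repeat_count]).  Going around an odd number of steps transposes
    the grid, hence exchanges the types, so no such coloring takes the same
    values on the grids over x and over x + N with N odd
    ([no_transposed_return]).  But a Baire measurable coloring must do exactly
    that: off a meager set it is locally constant, and N = 3 ^ n moves a
    point x by less and less as n grows ([coloring_lower_bound]).  Borel
    colorings are Baire measurable, so the bound holds for them too.

    Conversely 2k - 1 colors allow a coloring that passes from columns to rows
    in three steps ([cycle_color]).  It depends on the cell and on x 0 in
    Z / 3 only, hence is continuous. *)

Set Implicit Arguments.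
Unset Strict Implicit.
Unset Printing Implicit Defensive.

Import Order.TTheory GRing.Theory Num.Theory.
Local Open Scope classical_set_scope.
Local Open Scope card_scope.

(** * Polish spaces from agreement relations *)

(** E n is read as agreement up to precision n.  These relations are the
    closed balls of radius 2 ^ - n of an ultrametric; E 0 is required to be
    total so that all distances are at most 1. *)
Section Agreement.
Local Open Scope ring_scope.
Variables (R : realType) (T : topologicalType) (E : nat -> T -> T -> Prop).
Hypothesis E0 : forall x y, E 0 x y.
Hypothesis Esym : forall n x y, E n x y -> E n y x.
Hypothesis Etrans : forall n x y z, E n x y -> E n y z -> E n x z.
Hypothesis Edecr : forall n x y, E n.+1 x y -> E n x y.
Hypothesis Esep : forall x y, (forall n, E n x y) <-> x = y.
Hypothesis Enbhs : forall x (A : set T), nbhs x A <-> exists n, E n x `<=` A.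
Hypothesis Ecomplete : forall u : nat -> T,
  (forall n, E n (u n) (u n.+1)) -> exists l, forall n, E n (u n) l.

Lemma agreement_le m n x y : (m <= n)%N -> E n x y -> E m x y.
Proof.
move/subnK <-; elim: (n - m)%N => [//|i IH].
by rewrite addSn => /Edecr.
Qed.

Lemma agreement_dist : exists d : T -> T -> R, forall x y,
  (d x y = 0 /\ x = y) \/
  exists n, [/\ d x y = 2^-1 ^+ n, E n x y & ~ E n.+1 x y].
Proof.
have H (p : T * T) : exists r : R, (r = 0 /\ p.1 = p.2) \/
    exists n, [/\ r = 2^-1 ^+ n, E n p.1 p.2 & ~ E n.+1 p.1 p.2].
  case: p => x y /=.
  have [xy|nxy] := pselect (x = y); first by exists 0; left.
  have ex : exists n, `[< ~ E n x y >].
    apply: contrapT => h; apply: nxy; apply/Esep => n.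
    by apply: contrapT => nE; apply: h; exists n; apply/asboolP.
  case: (ex_minnP ex) => -[|n] /asboolP nE nmin; first by case: nE.
  exists (2^-1 ^+ n); right; exists n; split=> //.
  apply: contrapT => nEn; have := nmin n; rewrite ltnn => h.
  by have := h (asboolT nEn).
have [f fP] := choice H.
by exists (fun x y => f (x, y)) => x y; exact: (fP (x, y)).
Qed.

Lemma polish_agreement : separable T -> polish R T.
Proof.
move=> sepT; split=> //; have [d dP] := agreement_dist.
have half_gt0 n : 0 < (2^-1 : R) ^+ n by rewrite exprn_gt0 // invr_gt0.
have half_le m n : ((2^-1 : R) ^+ m <= 2^-1 ^+ n) = (n <= m)%N.
  by rewrite ler_iXn2l // ?invr_gt0 // invf_lt1 // ltr1n.
have Erefl n x : E n x x by move: n; apply/Esep.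
have dE n x y : d x y <= 2^-1 ^+ n <-> E n x y.
  have [[-> ->]|[m [-> Em nEm]]] := dP x y.
    by split=> // _; exact: ltW.
  rewrite half_le; split=> [nm|En]; first exact: agreement_le Em.
  rewrite leqNgt; apply/negP => mn.
  by apply: nEm; exact: agreement_le En.
have d_ge0 x y : 0 <= d x y.
  by have [[-> _]|[m [-> _ _]]] := dP x y => //; exact: ltW.
have d0 x y : d x y = 0 <-> x = y.
  split=> [xy|->]; last first.
    have [[]//|[m [_ _ []]]] := dP y y; exact: Erefl.
  by apply/Esep => n; apply/dE; rewrite xy ltW.
have small (e : R) : 0 < e -> exists n, 2^-1 ^+ n < e.
  move=> e0; exists (Num.bound e^-1).
  have en : e^-1 < (Num.bound e^-1)%:R.
    by apply: archi_boundP; rewrite invr_ge0 ltW.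
  rewrite exprVn invf_plt ?posrE ?exprn_gt0 //.
  by apply: lt_le_trans en _; rewrite -natrX ler_nat ltnW // ltn_expl.
exists d; split.
- split=> //.
  + have dle x y : d y x <= d x y.
      have [[-> ->]|[m [-> Em _]]] := dP x y; first by rewrite (d0 y y).2.
      by apply/dE; exact: Esym.
    by move=> x y; apply/eqP; rewrite eq_le !dle.
  + move=> x y z.
    have [[-> ->]|[m [dm Em _]]] := dP x y; first by rewrite add0r.
    have [[-> <-]|[n [dn En _]]] := dP y z; first by rewrite addr0.
    have : d x z <= 2^-1 ^+ (minn m n).
      apply/dE; apply: (@Etrans _ _ y).
        by apply: agreement_le Em; rewrite geq_minl.
      by apply: agreement_le En; rewrite geq_minr.
    move=> /le_trans; apply; rewrite dm dn.
    by case: leqP => _; rewrite ?lerDl ?lerDr ltW.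
- move=> x A; split=> [/Enbhs[n nA]|[e e0 eA]].
    exists (2^-1 ^+ n) => // y /= /ltW /dE; exact: nA.
  apply/Enbhs; have [n ne] := small e e0; exists n => y /dE xy.
  by apply: eA => /=; exact: le_lt_trans ne.
- move=> u uC.
  have /choice[N NP] n : exists N : nat, forall i j,
      (N <= i)%N -> (N <= j)%N -> E n (u i) (u j).
    have [N NP] := uC _ (half_gt0 n); exists N => i j Ni Nj.
    by apply/dE; exact/ltW/NP.
  (* The maximum makes the moduli of convergence monotone. *)
pose M n := \max_(i < n.+1) N i.
  have NM n m : (n <= m)%N -> (N n <= M m)%N.
    by move=> nm; exact: (leq_bigmax (Ordinal (nm : (n < m.+1)%N))).
  have [n|l lP] := @Ecomplete (u \o M).
    by apply: NP; apply: NM.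
  exists l => A /Enbhs[n nA].
  exists (M n) => //= m /= nm; apply/nA/Esym/Etrans/(lP n).
  by apply: NP; [exact: leq_trans (NM n n _) nm|exact: NM].
Qed.

End Agreement.

Lemma discrete_polish (R : realType) (T : discreteTopologicalType) :
  countable [set: T] -> polish R T.
Proof.
move=> cT; apply: (@polish_agreement _ _ (fun n x y => n = 0 \/ x = y)).
- by left.
- by move=> n x y [->|->]; [left|right].
- by move=> n x y z [->|->] yz; [left|].
- by move=> n x y [//|->]; right.
- by move=> x y; split=> [/(_ 1)[]//|-> n]; right.
- move=> x A; rewrite nbhs_principalE; split.
    by move=> /principal_filterP Ax; exists 1%N => y [//|<-].
  by move=> [n nA]; apply/principal_filterP; apply: nA; right.
- move=> u uP; exists (u 1%N) => -[|n]; first by left.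
  right; elim: n => // n <-.
  by case: (uP n.+1).
- by exists setT => //; move=> O [x Ox] _; exists x.
Qed.

(** * Colorings of the tensor square of a clique *)

Lemma card_finType (T : finType) : [set: T] #= `I_#|T|.
Proof.
have -> : [set: T] = enum_val @` [set: 'I_#|T|].
  apply/esym; rewrite -subTset => t _.
  by exists (enum_rank t); rewrite ?enum_rankK.
apply: card_eq_trans (_ : _ #= [set: 'I_#|T|]) _.
  by apply: inj_card_eq => a b _ _; exact: enum_val_inj.
by rewrite card_eq_sym; exact: card_II.
Qed.

Definition far k (p q : 'I_k * 'I_k) := (p.1 != q.1) && (p.2 != q.2).

Definition cell_transpose k (p : 'I_k * 'I_k) := (p.2, p.1).

Lemma far_sym k (p q : 'I_k * 'I_k) : far p q = far q p.
Proof. by rewrite /far eq_sym [p.2 == _]eq_sym. Qed.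

Lemma far_irr k (p : 'I_k * 'I_k) : far p p = false.
Proof. by rewrite /far eqxx. Qed.

Lemma far_transpose k (p q : 'I_k * 'I_k) :
  far (cell_transpose p) (cell_transpose q) = far p q.
Proof. by rewrite /far andbC. Qed.


Lemma avoid2 k (i j : 'I_k) : 2 < k -> exists r, (r != i) && (r != j).
Proof.
move=> k_gt2; apply/existsP; apply: contraT; rewrite negb_exists => /forallP h.
have : #|'I_k| <= #|[set i; j]%SET|.
  apply: subset_leq_card; apply/fintype.subsetP => r _.
  by have := h r; rewrite !inE negb_and !negbK.
by rewrite card_ord cards2; case: (_ != _) => /=; lia.
Qed.

(** This is where k > 2 enters: a third row and a third column are free.  It
    makes each component connected. *)
Lemma far_common k (p q : 'I_k * 'I_k) :
  2 < k -> exists r, far p r && far r q.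
Proof.
move=> k_gt2; have [i /andP[i1 i2]] := avoid2 p.1 q.1 k_gt2.
have [j /andP[j1 j2]] := avoid2 p.2 q.2 k_gt2.
by exists (i, j); rewrite /far /= i2 j2 eq_sym i1 eq_sym j1.
Qed.

Lemma card_far k (p : 'I_k * 'I_k) : #|[pred q | far p q]| = ((k - 1) ^ 2)%N.
Proof.
have -> : ((k - 1) ^ 2)%N = #|predX (predC1 p.1) (predC1 p.2)|.
  by rewrite cardX !cardC1 card_ord subn1 mulnn.
apply: eq_card => q; rewrite !inE /far.
by rewrite [q.1 == _]eq_sym [q.2 == _]eq_sym.
Qed.

Definition rows_repeat k m (c : 'I_k * 'I_k -> 'I_m) :=
  forall i, exists j j', j != j' /\ c (i, j) = c (i, j').

Definition cols_repeat k m (c : 'I_k * 'I_k -> 'I_m) :=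
  rows_repeat (c \o @cell_transpose k).

(** A repetition-free row i and a repetition-free column j meet in one cell,
    and any other cell of the row is far from any other cell of the column,
    so together they carry k + (k - 1) colors. *)
Lemma repeat_dichotomy k m (c : 'I_k * 'I_k -> 'I_m) :
  m < 2 * k - 1 -> (forall p q, far p q -> c p <> c q) ->
  rows_repeat c \/ cols_repeat c.
Proof.
move=> m_lt cP; apply: contrapT => /not_orP[nrow ncol].
have /existsNP[i rowi] := nrow; have /existsNP[j colj] := ncol.
have injr j1 j2 : c (i, j1) = c (i, j2) -> j1 = j2.
  move=> e; apply/eqP/contraT => ne; exfalso; apply: rowi.
  by exists j1, j2.
have injc i1 i2 : c (i1, j) = c (i2, j) -> i1 = i2.
  move=> e; apply/eqP/contraT => ne; exfalso; apply: colj.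
  by exists i1, i2.
pose f (t : 'I_k + {i' | i' != i}) :=
  match t with inl j' => c (i, j') | inr i' => c (val i', j) end.
have cross j' (i' : {i' | i' != i}) : c (i, j') <> c (val i', j).
  have [->|ne] := eqVneq j' j.
    by move=> /injc e; have := valP i'; rewrite -e eqxx.
  by apply: cP; rewrite /far /= ne eq_sym (valP i').
have finj : injective f.
  move=> [a|a] [b|b] //= e; first by rewrite (injr _ _ e).
  - by case: (cross _ _ e).
  - by case: (cross _ _ (esym e)).
  - by congr inr; apply/val_inj/injc.
have := leq_card f finj.
rewrite card_sum card_sig card_ord cardC1 !card_ord; lia.
Qed.

(** The k colors repeated in the rows of c differ from each other and from
    the k colors repeated in the columns of c': of two cells in one row, at
    least one avoids a given column, and likewise with rows and columns
    exchanged, so for any two of these colors far cells can be found that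
    carry them. *)
Lemma repeat_count k m (c c' : 'I_k * 'I_k -> 'I_m) :
  (forall p q, far p q -> c p <> c q) ->
  (forall p q, far p q -> c' p <> c' q) ->
  (forall p q, far p q -> c p <> c' q) ->
  rows_repeat c -> cols_repeat c' -> 2 * k <= m.
Proof.
move=> cP cP' cross /choice[J /choice[J' JP]] /choice[I /choice[I' IP]].
have avoid (u v w : 'I_k) : u != v -> (u != w) \/ (v != w).
  by have [->|] := eqVneq u w; [rewrite eq_sym; right|left].
pose f (t : 'I_k + 'I_k) :=
  match t with inl i => c (i, J i) | inr j => c' (I j, j) end.
have hc i j : c (i, J i) <> c' (I j, j).
  have [neJ eJ] := JP i; have [neI /= eI] := IP j.
  have [s [-> sj]] : exists s, c (i, J i) = c (i, s) /\ s != j.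
    by have [h|h] := avoid _ _ j neJ; [exists (J i)|exists (J' i)].
  have [t [-> ti]] : exists t, c' (I j, j) = c' (t, j) /\ t != i.
    by have [h|h] := avoid _ _ i neI; [exists (I j)|exists (I' j)].
  by apply: cross; rewrite /far /= sj eq_sym ti.
have finj : injective f.
  move=> [a|a] [b|b] /= e.
  - congr inl; apply/eqP/contraT => ne; exfalso.
    have [neJ eJ] := JP a.
    have [h|h] := avoid _ _ (J b) neJ.
      by apply: (cP _ _ _ e); rewrite /far /= ne.
    by rewrite eJ in e; apply: (cP _ _ _ e); rewrite /far /= ne.
  - by case: (hc _ _ e).
  - by case: (hc _ _ (esym e)).
  - congr inr; apply/eqP/contraT => ne; exfalso.
    have [neI /= eI] := IP a.
    have [h|h] := avoid _ _ (I b) neI.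
      by apply: (cP' _ _ _ e); rewrite /far /= ne andbT.
    by rewrite eI in e; apply: (cP' _ _ _ e); rewrite /far /= ne andbT.
have := leq_card f finj.
by rewrite card_sum !card_ord; lia.
Qed.

(** Consecutive layers have the same type by [repeat_count], whereas
    transposition exchanges the types and no layer has both. *)
Lemma no_transposed_return k m N (g : nat -> 'I_k * 'I_k -> 'I_m) :
  m < 2 * k - 1 ->
  (forall n p q, far p q -> g n p <> g n q) ->
  (forall n p q, far p q -> g n p <> g n.+1 q) ->
  ~ (forall p, g N p = g 0 (cell_transpose p)).
Proof.
move=> m_lt same next ret.
have excl n n' : (forall p q, far p q -> g n p <> g n' q) ->
    rows_repeat (g n) -> cols_repeat (g n') -> False.
  by move=> h r c; have := repeat_count (same n) (same n') h r c; lia.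
have di n := repeat_dichotomy m_lt (same n).
have rowsN n : rows_repeat (g 0) -> rows_repeat (g n).
  move=> r0; elim: n => // n r; have [//|c] := di n.+1.
  by case: (excl n n.+1 (@next n) r c).
have colsN n : cols_repeat (g 0) -> cols_repeat (g n).
  move=> c0; elim: n => // n c; have [r|//] := di n.+1.
  have nextC p q : far p q -> g n.+1 p <> g n q.
    by rewrite far_sym => /(next n) h /esym/h.
  by case: (excl _ _ nextC r c).
have gN : g N \o @cell_transpose k = g 0.
  by apply/funext => -[i j] /=; rewrite ret.
have gN' : g 0 \o @cell_transpose k = g N.
  by apply/funext => -[i j] /=; rewrite ret.
have [r|c] := di 0.
  apply: (excl 0 0) => //; first exact: same.
  by rewrite /cols_repeat gN'; exact: rowsN.
apply: (excl 0 0) => //; first exact: same.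
by rewrite -gN; exact: (colsN N c).
Qed.

(** * The twisted graph and its Polish space *)

(** The full product of the groups Z / 3 ^ n.+1, which contains the 3-adic
    integers as the compatible sequences.  Adding an integer acts on each
    coordinate separately, without carries. *)
Definition odometer := forall n : nat, 'Z_(3 ^ n.+1).

Definition shift (z : int) (x : odometer) : odometer :=
  fun n => (x n + z%:~R)%R.

Lemma shift0 x : shift 0 x = x.
Proof. by apply: functional_extensionality_dep => n; rewrite /shift addr0. Qed.

Lemma shiftD z z' x : shift (z + z')%R x = shift z (shift z' x).
Proof.
apply: functional_extensionality_dep => n.
by rewrite /shift intrD addrA addrAC.
Qed.

Lemma gt1_pow3 n : 1 < 3 ^ n.+1.
Proof. by rewrite -{1}(expn0 3) ltn_exp2l. Qed.

Lemma Zp_nat_eq0 n m : ((m%:R : 'Z_(3 ^ n.+1)) == 0)%R = (3 ^ n.+1 %| m).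
Proof. by rewrite -val_eqE /= val_Zp_nat ?gt1_pow3. Qed.

(** An integer that fixes a point is divisible by every power of 3. *)
Lemma shift_free z x : shift z x = x -> z = 0%R.
Proof.
move=> zx; have zero n : (z%:~R = 0 :> 'Z_(3 ^ n.+1))%R.
  by apply: (addrI (x n)); rewrite addr0 -[in RHS]zx.
apply/eqP; rewrite -absz_eq0; apply/eqP.
have : (3 ^ `|z|.+1 %| `|z|)%N.
  rewrite -Zp_nat_eq0; have := zero `|z|%N.
  by case: z {zx zero} => m;
    rewrite ?NegzE ?abszN ?mulrNz => /eqP; rewrite ?oppr_eq0.
case: (posnP `|z|%N) => // z0 /(dvdn_leq z0).
by rewrite leqNgt ltnW // ltn_expl.
Qed.

Lemma shift_inj x : injective (shift^~ x).
Proof.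
move=> z z' /= e; apply/eqP; rewrite -subr_eq0; apply/eqP.
apply: (@shift_free _ (shift z' x)).
by rewrite -shiftD subrK.
Qed.

(** The action is recurrent along odd times: this is the property of the
    base on which the lower bound rests. *)
Lemma shift_pow3 n x i : i < n -> shift (3 ^ n)%N x i = x i.
Proof.
move=> lt_in; rewrite /shift -[X in (_ + X)%R]/((3 ^ n)%:R)%R.
suff /eqP -> : ((3 ^ n)%:R : 'Z_(3 ^ i.+1))%R == 0%R by rewrite addr0.
by rewrite Zp_nat_eq0 dvdn_exp2l.
Qed.

Section Space.
Variable k : nat.
Local Notation cell := ('I_k * 'I_k)%type.

Definition twist (z : int) (p : cell) :=
  if odd `|z| then cell_transpose p else p.

Lemma cell_transposeK : involutive (@cell_transpose k).
Proof. by case. Qed.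

Lemma twistD z z' p : twist (z + z')%R p = twist z (twist z' p).
Proof.
have -> : twist (z + z')%R p =
    if odd `|z| (+) odd `|z'| then cell_transpose p else p.
  by rewrite /twist; congr (if _ then _ else _); lia.
by rewrite /twist; case: (odd _) (odd _) => -[] //; rewrite cell_transposeK.
Qed.

Lemma twistN z p : twist (- z)%R p = twist z p.
Proof. by rewrite /twist abszN. Qed.

Lemma twistK z : involutive (twist z).
Proof. by move=> p; rewrite -{1}twistN -twistD addNr. Qed.

Lemma far_twist z p q : far (twist z p) (twist z q) = far p q.
Proof. by rewrite /twist; case: ifP => _; rewrite ?far_transpose. Qed.

Definition grid_bundle : Type := (odometer * ('I_k * 'I_k))%type.

(** The cell is compared from precision 1 on, so that [agree 0] is total. *)
Definition agree n (u v : grid_bundle) :=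
  (0 < n -> u.2 = v.2) /\ forall i, i < n -> u.1 i = v.1 i.

Lemma agree_refl n u : agree n u u. Proof. by []. Qed.

Lemma agree_sym n u v : agree n u v -> agree n v u.
Proof. by move=> [e h]; split=> [/e//|i /h]. Qed.

Lemma agree_trans n u v w : agree n u v -> agree n v w -> agree n u w.
Proof.
move=> [e h] [e' h']; split=> [n0|i lt_in]; first by rewrite e ?e'.
by rewrite h ?h'.
Qed.

Lemma agree_le m n u v : m <= n -> agree n u v -> agree m u v.
Proof.
move=> mn [e h]; split=> [m0|i im]; first by apply/e/(leq_trans m0).
exact/h/(leq_trans im).
Qed.

HB.instance Definition _ := gen_eqMixin grid_bundle.
HB.instance Definition _ := gen_choiceMixin grid_bundle.
HB.instance Definition _ := hasNbhs.Build grid_bundle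
  (fun u => [set A | exists n, agree n u `<=` A]).

Lemma grid_bundle_nbhs_filter (u : grid_bundle) : ProperFilter (nbhs u).
Proof.
apply: Build_ProperFilter_ex; first by move=> A [n nA]; exists u; exact: nA.
split; first by exists 0.
  move=> A B [m mA] [n nB]; exists (maxn m n) => v uv; split.
    by apply/mA/agree_le/uv/leq_maxl.
  by apply/nB/agree_le/uv/leq_maxr.
by move=> A B AB [n nA]; exists n; exact: subset_trans AB.
Qed.

Lemma grid_bundle_nbhs_singleton (u : grid_bundle) (A : set grid_bundle) :
  nbhs u A -> A u.
Proof. by move=> [n]; apply. Qed.

Lemma grid_bundle_nbhs_nbhs (u : grid_bundle) (A : set grid_bundle) :
  nbhs u A -> nbhs u (nbhs^~ A).
Proof.
move=> [n nA]; exists n => v uv; exists n => w vw.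
by apply: nA; exact: agree_trans vw.
Qed.

HB.instance Definition _ := Nbhs_isNbhsTopological.Build grid_bundle
  grid_bundle_nbhs_filter grid_bundle_nbhs_singleton grid_bundle_nbhs_nbhs.

Lemma grid_bundle_nbhsE (u : grid_bundle) (A : set grid_bundle) :
  nbhs u A <-> exists n, agree n u `<=` A.
Proof. by []. Qed.

Lemma grid_bundle_separable : separable grid_bundle.
Proof.
pose f (t : seq nat * cell) : grid_bundle := (fun n => inZp (nth 0 t.1 n), t.2).
exists (range f).
  apply: (@sub_countable _ _ _ [set: seq nat * cell]).
    exact: card_image_le.
  exact: countableP.
move=> O [[x p] Ox]; rewrite openE => /(_ _ Ox)[n nO].
exists (f (mkseq (fun i => val (x i)) n, p)); split.
  apply: nO; split=> //= i lt_in; apply/val_inj.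
  by rewrite nth_mkseq //= modn_small.
by exists (mkseq (fun i => val (x i)) n, p).
Qed.

Lemma grid_bundle_polish (R : realType) : polish R grid_bundle.
Proof.
apply: (@polish_agreement _ _ agree).
- by [].
- exact: agree_sym.
- exact: agree_trans.
- by move=> n x y; exact: agree_le.
- move=> [x p] [y q]; split=> [h|-> n]; last exact: agree_refl.
  congr pair; last by have [/= ->] := h 1.
  apply: functional_extensionality_dep => n.
  by have [_ /= ->] := h n.+1.
- exact: grid_bundle_nbhsE.
- move=> u uP; exists (fun i => (u i.+1).1 i, (u 1).2) => n; split=> /=.
    elim: n => // -[//|n] IH _; rewrite -IH //.
    by have [->] := uP n.+1.
  move=> i; elim: n => // n IH; rewrite ltnS leq_eqVlt => /predU1P[->//|lt_in].
  rewrite -IH //; by have [_ ->] := uP n.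
- exact: grid_bundle_separable.
Qed.

(** Parallel transport over the base: in the coordinates (z, p) of the point
    [act z (x, p)], the graph no longer shows any transposition. *)
Definition act (z : int) (u : grid_bundle) : grid_bundle :=
  (shift z u.1, twist z u.2).

Lemma act0 u : act 0 u = u.
Proof. by case: u => x p; rewrite /act shift0. Qed.

Lemma act_inj x z z' p p' : act z (x, p) = act z' (x, p') -> z = z' /\ p = p'.
Proof.
move=> [/shift_inj -> h]; split=> //.
exact: (can_inj (twistK z')).
Qed.

(** Transporting e.1 by z brings it to the grid of e.2, where the cells can
    be compared. *)
Definition twisted_graph : set (grid_bundle * grid_bundle) :=
  [set e | exists z : int, [/\ (`|z| <= 1)%R, (act z e.1).1 = e.2.1
                             & far (act z e.1).2 e.2.2]].

Lemma twisted_graph_act x z p v : twisted_graph (act z (x, p), v) <->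
  exists z' p', [/\ (`|z' - z| <= 1)%R, far p p' & v = act z' (x, p')].
Proof.
split=> [[d /= [d1]]|[z' [p' [d1 pp' ->]]]].
  case: v => y q /= yE; rewrite -twistD => pq.
  exists (d + z)%R, (twist (d + z) q); split; first by rewrite addrK.
    by rewrite -(far_twist (d + z)) twistK.
  by rewrite /act twistK shiftD /= yE.
exists (z' - z)%R; split=> //=; first by rewrite -shiftD subrK.
by rewrite -twistD subrK far_twist.
Qed.

Lemma twisted_graph_actP x z p z' p' :
  twisted_graph (act z (x, p), act z' (x, p')) <->
  (`|z' - z| <= 1)%R /\ far p p'.
Proof.
split=> [/twisted_graph_act[w [q [h1 h2 /act_inj[-> ->]]]]//|[h1 h2]].
by apply/twisted_graph_act; exists z', p'.
Qed.

Lemma twisted_graphP u v : twisted_graph (u, v) <->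
  exists z p, [/\ (`|z| <= 1)%R, far u.2 p & v = act z (u.1, p)].
Proof.
case: u => x p; rewrite -[in X in X <-> _](act0 (x, p)) twisted_graph_act.
by split=> -[z [q [h1 h2 h3]]]; exists z, q; move: h1; rewrite subr0.
Qed.

Lemma twisted_graph_is_graph : is_graph twisted_graph.
Proof.
split=> [x y|x].
  move=> /twisted_graphP[z [p [z1 xp ->]]]; case: x xp => x q xp /=.
  rewrite -[(x, q)]act0; apply/twisted_graph_actP.
  by rewrite sub0r normrN far_sym.
case: x => x p; rewrite -[(x, p)]act0 => /twisted_graph_actP[_].
by rewrite far_irr.
Qed.

(** Each of the three possible displacements z is refuted at a finite
    precision, so non-adjacency is an open condition. *)
Lemma twisted_graph_closed_level u v : ~ twisted_graph (u, v) ->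
  exists n, forall u' v', agree n u u' -> agree n v v' ->
    ~ twisted_graph (u', v').
Proof.
move=> nG.
have level (z : int) : (`|z| <= 1)%R -> exists n, forall u' v',
    agree n u u' -> agree n v v' ->
    ~ ((act z u').1 = v'.1 /\ far (act z u').2 v'.2).
  move=> z1; have [e|ne] := pselect ((act z u).1 = v.1); last first.
    have /existsNP[i nei] : ~ forall i, shift z u.1 i = v.1 i.
      by move=> h; apply: ne; apply: functional_extensionality_dep.
    exists i.+1 => u' v' [_ uu'] [_ vv'] [/(congr1 (fun x => x i)) e _].
    by apply: nei; rewrite vv' // -e /= /shift uu'.
  exists 1 => u' v' [uu' _] [vv' _] [_]; rewrite /= -uu' // -vv' // => f.
  by apply: nG; exists z.
have [n0 h0] := level 0%R isT; have [n1 h1] := level 1%R isT.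
have [n2 h2] := level (-1)%R isT.
exists (maxn n0 (maxn n1 n2)) => u' v' uu' vv' [z [z1 e f]].
have [z0|[z0|z0]] : (z = 0 \/ z = 1 \/ z = -1)%R by lia.
- apply: (h0 u' v'); last by rewrite -z0.
    by apply: agree_le uu'; rewrite leq_maxl.
  by apply: agree_le vv'; rewrite leq_maxl.
- apply: (h1 u' v'); last by rewrite -z0.
    by apply: agree_le uu'; lia.
  by apply: agree_le vv'; lia.
- apply: (h2 u' v'); last by rewrite -z0.
    by apply: agree_le uu'; lia.
  by apply: agree_le vv'; lia.
Qed.

Lemma twisted_graph_borel : borel twisted_graph.
Proof.
rewrite -[twisted_graph]setCK -setTD; apply: sigma_algebraCD.
apply: sub_sigma_algebra.
rewrite openE => -[u v] /twisted_graph_closed_level[n nG].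
exists (agree n u, agree n v) => /=; first by split; exists n.
by move=> [u' v'] [/= ? ?]; exact: nG.
Qed.

Lemma twisted_graph_regular : regular (3 * (k - 1) ^ 2) twisted_graph.
Proof.
move=> u.
(* Displacements -1, 0, 1 are indexed by 0, 1, 2. *)
pose D := ('I_3 * {p | far u.2 p})%type.
pose f (t : D) := act (Posz t.1 - 1)%R (u.1, val t.2).
have -> : [set v | twisted_graph (u, v)] = f @` [set: D].
  apply/seteqP; split.
  move=> v /twisted_graphP[z [p [z1 up ->]]].
  have zlt : (absz (z + 1)%R < 3)%N by lia.
  exists (Ordinal zlt, exist _ p up) => //=.
  by rewrite /f /=; congr (act _ _); lia.
  move=> _ [[i [p up]] _ <-].
  apply/twisted_graphP; exists (Posz i - 1)%R, p; split=> //.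
  by case: i => i /=; lia.
have finj : injective f.
  move=> [i p] [j q] /act_inj[/= ij pq]; congr pair; last exact: val_inj.
  by apply: val_inj => /=; lia.
apply: (@card_eq_trans _ _ _ _ [set: D]).
  by apply: inj_card_eq => a b _ _; exact: finj.
have -> : (3 * (k - 1) ^ 2)%N = #|{: D}|.
  by rewrite card_prod card_ord card_sig -(card_far u.2); congr (_ * _).
exact: card_finType.
Qed.

End Space.

(** * Components and ends *)

Section ClassOf.
Variables (T : Type).
Implicit Types (G : set (T * T)).

Lemma class_of_refl G x : class_of G x x. Proof. exact: rst_refl. Qed.

Lemma class_of_edge G x y : G (x, y) -> class_of G x y.
Proof. exact: rst_step. Qed.

Lemma class_of_sym G x y : class_of G x y -> class_of G y x.
Proof. exact: rst_sym. Qed.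

Lemma class_of_trans G x y z :
  class_of G x y -> class_of G y z -> class_of G x z.
Proof. exact: rst_trans. Qed.

Lemma class_of_eq G x y : class_of G x y -> class_of G x = class_of G y.
Proof.
move=> xy; apply/seteqP; split=> z; last exact: class_of_trans.
exact/class_of_trans/class_of_sym.
Qed.

(** The usual way to separate two components: a property that no edge
    changes. *)
Lemma class_of_inv G (P : T -> Prop) x y :
  (forall u v, G (u, v) -> P u <-> P v) -> class_of G x y -> P x -> P y.
Proof.
move=> GP xy; suff [] : P x <-> P y by [].
elim: xy => {x y} [u v /GP //|//|u v _ [h1 h2]|u v w _ [h1 h2] _ [h3 h4]].
  by split.
by split=> [/h1/h3|/h4/h2].
Qed.

Lemma class_of_sub G G' x y : G `<=` G' -> class_of G x y -> class_of G' x y.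
Proof.
move=> GG'; elim=> {x y} [u v /GG'|u|u v _|u v w _ h1 _ h2].
- exact: class_of_edge.
- exact: class_of_refl.
- exact: class_of_sym.
- exact: class_of_trans h1 h2.
Qed.

End ClassOf.

Lemma set2_image T (a b : T) :
  [set a; b] = (fun n => if n == 0 then a else b) @` `I_2.
Proof.
apply/seteqP; split=> [_ /= [->|->]|_ [[|n] _ <-]].
- by exists 0.
- by exists 1.
- by left.
- by right.
Qed.

Lemma card_set2_le T (a b : T) : [set a; b] #<= `I_2.
Proof. by rewrite set2_image; exact: card_image_le. Qed.

Lemma card_set2_eq T (a b : T) : a <> b -> [set a; b] #= `I_2.
Proof.
move=> ab; rewrite set2_image.
by apply: inj_card_eq => -[|[|i]] [|[|j]]; rewrite ?inE //= => _ _ // /esym.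
Qed.

Section Ends.
Variable k : nat.
Hypothesis k_gt2 : 2 < k.
Local Notation cell := ('I_k * 'I_k)%type.
Local Notation G := (@twisted_graph k).

(** The walk stays within the layers z, ..., z', so it survives the deletion
    of anything outside them. *)
Lemma layers_connected (A : set (grid_bundle k)) x (z z' : int) (p q : cell) :
  (z <= z')%R ->
  (forall w r, (z <= w <= z')%R -> A (act w (x, r))) ->
  class_of (induced G A) (act z (x, p)) (act z' (x, q)).
Proof.
move=> zz'; have -> : z' = (z + Posz `|(z' - z)%R|)%R by lia.
move: (absz _) => n; elim: n q => [|n IH] q hA.
  have [r /andP[pr rq]] := far_common p q k_gt2.
  apply: (@class_of_trans _ _ _ (act z (x, r))).
    apply: class_of_edge; split; last by split; apply: hA; lia.
    by apply/twisted_graph_actP; rewrite subrr.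
  apply: class_of_edge; split; last by split; apply: hA; lia.
  by apply/twisted_graph_actP; split=> //; lia.
have [r /andP[_ rq]] := far_common p q k_gt2.
apply: (class_of_trans (IH r _)) => [w s zw|]; first by apply: hA; lia.
apply: class_of_edge; split; last by split; apply: hA; lia.
by apply/twisted_graph_actP; split=> //; lia.
Qed.

Definition thread (x : odometer) : set (grid_bundle k) :=
  [set u | exists z p, u = act z (x, p)].

Lemma thread_edge x u v : G (u, v) -> thread x u <-> thread x v.
Proof.
have imp a b : G (a, b) -> thread x a -> thread x b.
  move=> ab [z [p ap]]; move: ab; rewrite ap.
  by move=> /twisted_graph_act[z' [q [_ _ ->]]]; exists z', q.
by move=> uv; split; apply: imp => //; apply: (twisted_graph_is_graph k).1.
Qed.

Lemma class_of_thread x p : class_of G (x, p) = thread x.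
Proof.
apply/seteqP; split=> [u xu|u [z [q ->]]].
  apply: (class_of_inv (@thread_edge x) xu).
  by exists 0%R, p; rewrite act0.
rewrite -[(x, p)]act0.
apply: (@class_of_sub _ (induced G setT)) => [[a b] []//|].
have [z0|z0] := lerP 0 z; first exact: layers_connected.
by apply/class_of_sym/layers_connected => //; lia.
Qed.

Section Dividing.
Variable x : odometer.
Local Notation C := (thread x).

Lemma bounded_part (F : set (grid_bundle k)) : finite_set F ->
  exists M : nat, forall z p, F (act z (x, p)) -> `|z| <= M.
Proof.
move=> finF; pose f (t : int * cell) := act t.1 (x, t.2).
have finj : injective f by move=> [z p] [z' q] /act_inj[/= -> ->].
have /finite_seqP[s sP] : finite_set (f @^-1` F).
  by apply: finite_preimage => // a b _ _ /finj.
exists (\max_(t <- s) `|t.1|) => z p Fzp.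
have zs : (z, p) \in s by have : (f @^-1` F) (z, p) by []; rewrite sP.
exact: (@leq_bigmax_seq _ s xpredT (fun t : int * cell => `|t.1|%N) _ zs isT).
Qed.

Lemma finite_layers (M : nat) :
  finite_set [set u : grid_bundle k |
    exists z p, (`|z| <= M)%N /\ u = act z (x, p)].
Proof.
pose f (t : 'I_(2 * M).+1 * cell) := act (Posz t.1 - Posz M)%R (x, t.2).
apply: (@sub_finite_set _ _ (f @` setT)); last exact/finite_image/finite_finset.
move=> _ [z [p [zM ->]]].
have zlt : (absz (z + Posz M)%R < (2 * M).+1)%N by lia.
by exists (Ordinal zlt, p) => //; rewrite /f /=; congr (act _ _); lia.
Qed.

Local Notation remainder F := (induced (induced G C) (C `\` F)).

Lemma outside_bound (F : set (grid_bundle k)) (M : nat) w r :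
  (forall z p, F (act z (x, p)) -> `|z| <= M) ->
  M < `|w| -> (C `\` F) (act w (x, r)).
Proof.
by move=> FM Mw; split; [exists w, r|move=> /FM; rewrite leqNgt Mw].
Qed.

Lemma same_side_connected F (M : nat) (a b : int) p q :
  (forall z p, F (act z (x, p)) -> `|z| <= M) -> (a <= b)%R ->
  (forall w, (a <= w <= b)%R -> M < `|w|) ->
  class_of (remainder F) (act a (x, p)) (act b (x, q)).
Proof.
move=> FM ab far_w; apply: (@class_of_sub _ (induced G (C `\` F))).
  by move=> [c d] [Gcd [/= [Cc Fc] [Cd Fd]]].
apply: layers_connected => // w r wab.
exact/(outside_bound _ FM)/far_w.
Qed.

(** A finite set F lies in the layers up to M.  An infinite component of the
    remainder has a point beyond them, hence contains one of the two outer
    half-lines of layers. *)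
Lemma infinite_components_sub F M p D : 
  (forall z p, F (act z (x, p)) -> `|z| <= M) ->
  components (C `\` F) (remainder F) D -> infinite_set D ->
  D = class_of (remainder F) (act (Posz M.+1) (x, p)) \/
  D = class_of (remainder F) (act (- Posz M.+1)%R (x, p)).
Proof.
move=> FM [u uCF <-] infD.
have [v [uv [z [q [zM vE]]]]] : exists v, class_of (remainder F) u v /\
    exists z q, (M < `|z|)%N /\ v = act z (x, q).
  apply: contrapT => h; apply: infD; apply: sub_finite_set (finite_layers M).
  move=> v uv.
  have [z [q vE]] : C v.
    apply: (class_of_inv _ uv); last by case: uCF.
    by move=> a b [[]/thread_edge].
  exists z, q; split=> //; rewrite leqNgt; apply/negP => zM.
  by apply: h; exists v; split=> //; exists z, q.
rewrite (class_of_eq uv) vE.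
have [z0|z0] := lerP 0 z; [left|right].
  by apply/esym/class_of_eq; apply: (same_side_connected _ _ FM); lia.
by apply/class_of_eq; apply: (same_side_connected _ _ FM); lia.
Qed.

Lemma class_of_infinite G' (s : int) (p : cell) y :
  `|s| = 1 -> (forall n : nat, class_of G' y (act (s * Posz n.+1)%R (x, p))) ->
  infinite_set (class_of G' y).
Proof.
move=> s1 h fin; apply: infinite_nat.
pose f (n : nat) := act (s * Posz n.+1)%R (x, p).
have -> : [set: nat] = f @^-1` class_of G' y.
  by apply/esym; rewrite -subTset => n _; exact: h.
apply: finite_preimage => // m n _ _ /act_inj[e _].
have s2 : (s = 1 \/ s = -1)%R by lia.
by case: s2 e => ->; lia.
Qed.

(** Deleting layer 0 leaves two parts: no edge joins a positive layer to a
    negative one. *)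
Lemma thread_two_ends (p : cell) : component_has_ends G C 2.
Proof.
split; last first.
  move=> F m FC finF m_gt2 div.
  have [M FM] := bounded_part finF.
  have : `I_m #<= `I_2.
    apply: card_le_trans (card_set2_le
      (class_of (remainder F) (act (Posz M.+1) (x, p)))
      (class_of (remainder F) (act (- Posz M.+1)%R (x, p)))).
    rewrite -(card_le_eql div); apply: subset_card_le => D [compD infD].
    exact: infinite_components_sub FM compD infD.
  by rewrite card_le_II leqNgt m_gt2.
pose F : set (grid_bundle k) :=
  [set u | exists z p, (`|z| <= 0)%N /\ u = act z (x, p)].
exists F; split; first by move=> _ [z [q [_ ->]]]; exists z, q.
  exact: finite_layers.
have FM z q : F (act z (x, q)) -> `|z| <= 0 by move=> [w [r [w0 /act_inj[->]]]].
pose R := class_of (remainder F) (act 1 (x, p)).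
pose L := class_of (remainder F) (act (-1)%R (x, p)).
pose P := [set u : grid_bundle k |
  exists (z : int) q, (0 < z)%R /\ u = act z (x, q)].
have PF u v : remainder F (u, v) -> P u <-> P v.
  move=> [[uv _] [/= [[z [q uE]] nFu] [[z' [q' vE]] nFv]]].
  have zN0 : z <> 0%R.
    by move=> z0; apply: nFu; exists z, q; split=> //; rewrite z0.
  have z'N0 : z' <> 0%R.
    by move=> z0; apply: nFv; exists z', q'; split=> //; rewrite z0.
  move: uv; rewrite uE vE => /twisted_graph_actP[zz' _].
  split=> -[w [r [w0 /act_inj[e _]]]]; [exists z', q'|exists z, q].
    by split=> //; lia.
  by split=> //; lia.
have RL : R <> L.
  move=> RL; have neg : R (act (-1)%R (x, p)).
    by rewrite RL; exact: class_of_refl.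
  have [|w [r [w0 /act_inj[wE _]]]] := class_of_inv PF neg.
    by exists 1%R, p.
  by rewrite -wE in w0.
have ray (s : int) (n : nat) : `|s| = 1 ->
  class_of (remainder F) (act s (x, p)) (act (s * Posz n.+1)%R (x, p)).
  move=> s1; have [->|->] : (s = 1 \/ s = -1)%R by lia.
    by apply: (same_side_connected _ _ FM); lia.
  by apply/class_of_sym; apply: (same_side_connected _ _ FM); lia.
rewrite /divides.
have -> : [set D | components (C `\` F) (remainder F) D /\ infinite_set D] =
    [set R; L].
  apply/seteqP; split=> [D [compD infD]|D].
    exact: infinite_components_sub FM compD infD.
  have end_ (s : int) : `|s| = 1 -> components (C `\` F) (remainder F)
      (class_of (remainder F) (act s (x, p))) /\
      infinite_set (class_of (remainder F) (act s (x, p))).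
    move=> s1; split.
      by exists (act s (x, p)) => //; apply: (outside_bound _ FM); rewrite s1.
    by apply: (class_of_infinite s1) => n; exact: ray.
  by case=> ->; exact: end_.
exact: card_set2_eq.
Qed.

End Dividing.
End Ends.

(** * The chromatic number *)

Lemma card_ord_set n : [set: 'I_n] #= `I_n.
Proof. by rewrite card_eq_sym; exact: card_II. Qed.

Lemma card_index (Y : Type) m :
  [set: Y] #= `I_m -> exists e : Y -> 'I_m, injective e.
Proof.
move=> Ym; have /card_leP[f] : [set: Y] #<= [set: 'I_m].
  by rewrite (card_le_eql Ym) (card_le_eqr (card_ord_set m)) card_lexx.
have inY (y : Y) : y \in [set: Y] by rewrite inE.
exists (fun y => val (f (SigSub (inY y)))) => a b.
move=> /val_inj/(inj (in_setT _) (in_setT _)).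
by move/(congr1 val).
Qed.

Section Chromatic.
Variable k : nat.
Hypothesis k_gt2 : 2 < k.
Local Notation cell := ('I_k * 'I_k)%type.
Local Notation G := (@twisted_graph k).

Lemma thread_shift z x : @thread k (shift z x) = @thread k x.
Proof.
apply/seteqP; split=> u [w [p ->]].
  exists (w + z)%R, (twist (w + z) (twist w p)).
  by rewrite /act /= shiftD twistK.
exists (w - z)%R, (twist (w - z) (twist w p)).
by rewrite /act /= -shiftD subrK twistK.
Qed.

(** A choice of one base point r u in each orbit gives all points coordinates
    relative to it. *)
Lemma straighten : exists (r : grid_bundle k -> odometer)
  (h : grid_bundle k -> int) (p : grid_bundle k -> cell),
  (forall u, u = act (h u) (r u, p u)) /\
  (forall u v, G (u, v) -> r u = r v).
Proof.
pose i0 : 'I_k := Ordinal (ltnW (ltnW k_gt2)).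
pose r (u : grid_bundle k) : odometer :=
  (xget ((fun=> 0%R), (i0, i0)) (@thread k u.1)).1.
have /choice[h hP] (u : grid_bundle k) : exists z : int, shift z (r u) = u.1.
  have : exists v, @thread k u.1 v.
    by exists u, 0%R, u.2; rewrite -surjective_pairing act0.
  move=> /(xgetPex ((fun=> 0%R), (i0, i0)))[z [p e]]; exists (- z)%R.
  by rewrite /r e /= -shiftD addNr shift0.
exists r, h, (fun u => twist (h u) u.2); split.
  by case=> x q; rewrite /act /= hP twistK.
by move=> u v /twisted_graphP[z [p [_ _ ->]]]; rewrite /r /= thread_shift.
Qed.

Lemma twisted_graph_colorable : colorable G k.
Proof.
exists 'I_k; split; first exact: card_ord_set.
have [r [h [p [uE rE]]]] := straighten.
exists (fun u => (p u).1) => u v uv; move: (uv).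
rewrite (uE u) (uE v) (rE _ _ uv).
by move=> /twisted_graph_actP[_ /andP[/eqP]]; rewrite -uE -(rE _ _ uv) -uE.
Qed.

(** The diagonal cells of a grid are pairwise far. *)
Lemma clique_bound Y (c : grid_bundle k -> Y) m :
  [set: Y] #= `I_m -> coloring G c -> k <= m.
Proof.
move=> /card_index[e e_inj] cP.
pose f (i : 'I_k) := e (c (fun=> 0%R, (i, i))).
have f_inj : injective f.
  move=> i j /e_inj ij; apply/eqP/contraT => ne; exfalso; apply: cP ij.
  by apply/twisted_graphP; exists 0%R, (j, j); rewrite /far /= ne act0.
by have := leq_card f f_inj; rewrite !card_ord.
Qed.

Lemma twisted_graph_chromatic : chromatic_number G k.
Proof.
split; first exact: twisted_graph_colorable.
by move=> m [Y [Ym [c cP]]]; exact: clique_bound Ym cP.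
Qed.

End Chromatic.

(** * Category and the Baire property *)

Section Baire.
Variable T : topologicalType.
Implicit Types A B U : set T.

Lemma nowhere_dense_sub A B : A `<=` B -> nowhere_dense B -> nowhere_dense A.
Proof.
move=> AB nB; rewrite /nowhere_dense -subset0 -nB.
exact/interiorS/closureS.
Qed.

Lemma meager_sub A B : A `<=` B -> meager B -> meager A.
Proof.
move=> AB [F nF BE]; exists (fun n => F n `&` A) => [n|].
  exact: nowhere_dense_sub (nF n).
rewrite -setI_bigcupl -BE; apply/seteqP; split=> [x Ax|x []//].
by split=> //; exact: AB.
Qed.

Lemma meager_bigcup (A : nat -> set T) :
  (forall n, meager (A n)) -> meager (\bigcup_n A n).
Proof.
move=> mA; have /choice[F FP] n : exists F : nat -> set T,
    (forall i, nowhere_dense (F i)) /\ A n = \bigcup_i F i.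
  by have [F] := mA n; exists F.
exists (fun i => if unpickle i is Some t then F t.1 t.2 else set0) => [i|].
  case: unpickle => [[n j]|] /=; first exact: (FP n).1.
  by rewrite /nowhere_dense closure0 interior0.
apply/seteqP; split=> [x [n _]|x [i _]].
  rewrite (FP n).2 => -[j _ Fx]; exists (pickle (n, j)) => //.
  by rewrite pickleK.
case: unpickle => [[n j]|] //= Fx; exists n => //.
by rewrite (FP n).2; exists j.
Qed.

Lemma meager_nowhere_dense A : nowhere_dense A -> meager A.
Proof.
move=> nA; exists (fun=> A) => //.
by apply/seteqP; split=> [x Ax|x [n _]//]; exists 0.
Qed.

Lemma meager_setU A B : meager A -> meager B -> meager (A `|` B).
Proof.
move=> mA mB; have : meager (\bigcup_n (if n == 0 then A else B)).
  by apply: meager_bigcup => n; case: ifP.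
apply: meager_sub => x [Ax|Bx]; first by exists 0.
by exists 1.
Qed.

Lemma open_baire_property A : open A -> baire_property A.
Proof.
move=> oA; exists A => //; rewrite setDv setU0; apply: meager_nowhere_dense.
by rewrite /nowhere_dense closure0 interior0.
Qed.

Lemma closed_boundary_nowhere_dense A :
  closed A -> nowhere_dense (A `\` interior A).
Proof.
move=> cA; rewrite /nowhere_dense -subset0.
have /closure_id <- : closed (A `\` interior A).
  by rewrite setDE; apply: closedI => //; rewrite closedC; exact: open_interior.
move=> x xi; have [_] := interior_subset xi; apply.
by apply: interiorS xi; exact: subDsetl.
Qed.

Lemma baire_propertyC A : baire_property A -> baire_property (~` A).
Proof.
move=> [U oU mU]; exists (interior (~` U)); first exact: open_interior.
have mb : meager (~` U `\` interior (~` U)).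
  apply/meager_nowhere_dense/closed_boundary_nowhere_dense.
  by rewrite closedC.
apply: meager_sub (meager_setU mU mb) => x [[nA nI]|[iU nA]].
  have [Ux|nU] := pselect (U x); first by left; right.
  by right.
have [Ax|//] := pselect (A x).
  by left; left; split=> //; exact: interior_subset iU.
Qed.

Lemma baire_property_bigcup (A : nat -> set T) :
  (forall n, baire_property (A n)) -> baire_property (\bigcup_n A n).
Proof.
move=> bA; have /choice[U UP] n : exists U, open U /\
    meager ((A n `\` U) `|` (U `\` A n)).
  by have [U] := bA n; exists U.
exists (\bigcup_n U n); first by apply: bigcup_open => n _; exact: (UP n).1.
apply: meager_sub (meager_bigcup (fun n => (UP n).2)) => x.
move=> [[[n _ Ax] nU]|[[n _ Ux] nA]]; exists n => //; [left|right].
  by split=> // Ux; apply: nU; exists n.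
by split=> // Ax; apply: nA; exists n.
Qed.

(** Sets with the Baire property form a sigma-algebra.  For complements, the
    open set U approximating A is replaced by the interior of its complement,
    at the cost of the nowhere dense boundary of U. *)
Lemma borel_baire_property A : borel A -> baire_property A.
Proof.
apply: smallest_sub; last exact: open_baire_property.
split.
- exact/open_baire_property/open0.
- by move=> B; rewrite setTD; exact: baire_propertyC.
- exact: baire_property_bigcup.
Qed.

Lemma borel_fun_baire_measurable (U : topologicalType) (f : T -> U) :
  borel_fun f -> baire_measurable_fun f.
Proof.
move=> bf V oV; apply: borel_baire_property; apply: bf.
exact: sub_sigma_algebra.
Qed.

End Baire.

Lemma borel_baire_colorable (R : realType) (X : topologicalType)
  (G : set (X * X)) m : borel_colorable R G m -> baire_colorable R G m.
Proof.
move=> [Y [pY Ym [c [cP bc]]]]; exists Y; split=> //; exists c; split=> //.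
exact: borel_fun_baire_measurable.
Qed.

Lemma finite_polish_open (R : realType) (Y : topologicalType) m
  (e : Y -> 'I_m) :
  injective e -> polish R Y -> forall A : set Y, open A.
Proof.
move=> e_inj [_ [d [[d_ge0 d_eq0 _ _] dn _]]] A.
rewrite openE => y Ay; apply/dn.
have isolated (s : seq 'I_m) : exists2 r : R, (0 < r)%R &
    forall y', e y' \in s -> (d y y' < r)%R -> y' = y.
  elim: s => [|j s [r r0 IH]]; first by exists 1%R.
  have [[y1 [y1j y1y]]|h] := pselect (exists y1, e y1 = j /\ y1 <> y);
    last first.
    exists r => // y'; rewrite inE => /orP[/eqP y'j _|]; last exact: IH.
    by apply: contrapT => ne; apply: h; exists y'.
  exists (Num.min r (d y y1)).
    rewrite lt_min r0 lt_neqAle d_ge0 andbT eq_sym; apply/eqP.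
    by move=> /d_eq0 /esym.
  move=> y'; rewrite inE lt_min => /orP[/eqP y'j|y's] /andP[dr d1];
    last exact: IH.
  by move: d1; rewrite (e_inj y' y1) ?ltxx // y1j.
have [r r0 rP] := isolated (enum 'I_m).
by exists r => // y' /= /rP -> //; rewrite mem_enum.
Qed.

(** * The lower bound for Baire measurable colorings *)

Definition same_prefix n (x y : odometer) := forall i, i < n -> x i = y i.

(** The Baire category theorem, as it is needed for countably many
    requirements Q t: each prefix has an extension that forces Q t, and an
    infinite chain of extensions forces them all. *)
Lemma odometer_baire (Q : nat -> odometer -> Prop) :
  (forall t n x, exists n' x', [/\ n <= n', same_prefix n x x' &
     forall y, same_prefix n' x' y -> Q t y]) ->
  exists y, forall t, Q t y.
Proof.
move=> dense_Q.
have /choice[F FP] (a : nat * (nat * odometer)) : exists b : nat * odometer,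
    [/\ a.2.1 < b.1, same_prefix a.2.1 a.2.2 b.2 &
     forall y, same_prefix b.1 b.2 y -> Q a.1 y].
  have [n' [x' [nn' xx' h]]] := dense_Q a.1 a.2.1 a.2.2.
  exists (n'.+1, x'); split=> //= y x'y; apply: h => i lt_in'.
  exact/x'y/ltnW.
pose s t := iteri t (fun i b => F (i, b)) (0, fun=> 0%R).
have s_le m t : same_prefix (s t).1 (s t).2 (s (t + m)).2 /\
    (s t).1 <= (s (t + m)).1.
  elim: m => [|m [IH le]]; first by rewrite addn0.
  rewrite addnS; have [/ltnW le' h _] := FP (t + m, s (t + m)).
  split=> [i lt_i|]; last exact: leq_trans le'.
  by rewrite IH // [LHS]h //; exact: leq_trans le.
have s_ge t : t <= (s t).1.
  elim: t => // t IH; have [+ _ _] := FP (t, s t).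
  exact: leq_ltn_trans.
pose y : odometer := fun i => (s i.+1).2 i.
have y_lim t : same_prefix (s t).1 (s t).2 y.
  move=> i lt_it; rewrite /y; have [le|lt] := leqP t i.+1.
    by have [h _] := s_le (i.+1 - t) t; rewrite subnKC // in h; exact: h.
  have [h _] := s_le (t - i.+1) i.+1; rewrite subnKC 1?ltnW // in h.
  by apply/esym/h; exact: s_ge.
exists y => t; have [_ _ h] := FP (t, s t).
exact/h/(y_lim t.+1).
Qed.

Section LowerBound.
Variable k : nat.
Local Notation cell := ('I_k * 'I_k)%type.
Local Notation G := (@twisted_graph k).

(** All translates by the action and all cells are treated at once: they give
    only countably many nowhere dense sets of base points, as [act] maps
    cylinders to cylinders. *)
Lemma generic_odometer (I : countType) (N : I -> set (grid_bundle k)) :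
  (forall i, nowhere_dense (N i)) ->
  exists x, forall i (z : int) p, ~ N i (act z (x, p)).
Proof.
move=> nN.
pose Q t x := if unpickle t is Some a then
  ~ N a.1.1 (act a.1.2 (x, a.2)) else True : Prop.
suff [x xQ] : exists x, forall t, Q t x.
  exists x => i z p; have := xQ (pickle (i, z : int, p : cell)).
  by rewrite /Q pickleK.
apply: odometer_baire => t n x; rewrite /Q.
case: unpickle => [[[i z] p] /=|]; last by exists n, x.
pose u : grid_bundle k := act z (x, p).
have [v [uv nv]] : exists v, agree n.+1 u v /\ ~ closure (N i) v.
  apply: contrapT => h; have : interior (closure (N i)) u.
    exists n.+1 => v uv; apply: contrapT => nv; apply: h.
    by exists v.
  by rewrite nN.
have [n' n'N] : exists n', forall w, agree n' v w -> ~ N i w.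
  apply: contrapT => h; apply: nv => B [n' n'B].
  have /existsNP[w /not_implyP[vw /contrapT Nw]] :
      ~ forall w, agree n' v w -> ~ N i w.
    by move=> h'; apply: h; exists n'.
  by exists w; split=> //; exact: n'B.
exists (maxn n n'), (shift (- z) v.1); split; first exact: leq_maxl.
  move=> j lt_jn; have [_ h] := uv.
  have /esym vj := h j (ltnW lt_jn).
  by rewrite /shift vj intrN addrK.
move=> y hy; apply: n'N; split=> [_|j lt_jn'] /=.
  by have [<-] := uv.
rewrite /shift -hy ?leq_max ?lt_jn' ?orbT //.
by rewrite /shift intrN subrK.
Qed.

(** Over a generic x, the color of each point near (x, p) in the orbit is the
    color of (x, p).  The precision required can be taken uniform in p, since
    there are finitely many cells, and x + 3 ^ M lies within it. *)
Lemma coloring_lower_bound (R : realType) m :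
  baire_colorable R G m -> 2 * k - 1 <= m.
Proof.
move=> [Y [pY Ym [c [cP cB]]]]; rewrite leqNgt; apply/negP => m_lt.
have [e e_inj] := card_index Ym.
pose A j := [set u | e (c u) = j].
have /choice[U UP] j : exists U : set (grid_bundle k), open U /\
    meager ((A j `\` U) `|` (U `\` A j)).
  have oj := finite_polish_open e_inj pY [set y | e y = j].
  by have [U oU mU] := cB _ oj; exists U.
have /choice[N NP] j : exists F : nat -> set (grid_bundle k),
    (forall i, nowhere_dense (F i)) /\
    (A j `\` U j) `|` (U j `\` A j) = \bigcup_i F i.
  by have [_ [F]] := UP j; exists F.
have [x xN] := @generic_odometer ('I_m * nat)%type
  (fun a => N a.1 a.2) (fun a => (NP a.1).1 a.2).
have AU j z p : A j (act z (x, p)) <-> U j (act z (x, p)).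
  have nN : ~ ((A j `\` U j) `|` (U j `\` A j)) (act z (x, p)).
    by rewrite (NP j).2 => -[i _]; exact: (xN (j, i)).
  by split=> h; apply: contrapT => h'; apply: nN; [left|right].
have /choice[n nP] (p : cell) : exists n, forall v,
    agree n (x, p) v -> U (e (c (x, p))) v.
  have Up : U (e (c (x, p))) (x, p).
    by rewrite -[(x, p)]act0; apply/AU; rewrite act0.
  have := (UP (e (c (x, p)))).1; rewrite openE => /(_ _ Up) [n nU].
  by exists n.
pose M := \max_p n p.
pose g (t : nat) p := e (c (act t (x, p))).
apply: (@no_transposed_return k m (3 ^ M) g m_lt).
- move=> t p q pq /e_inj; apply: cP; apply/twisted_graph_actP.
  by rewrite subrr.
- move=> t p q pq /e_inj; apply: cP; apply/twisted_graph_actP.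
  by split=> //; lia.
move=> p; rewrite /g act0.
have twist3 q : twist (3 ^ M)%N q = cell_transpose q :> cell.
  by rewrite /twist /= oddX orbT.
suff : A (e (c (x, cell_transpose p))) (act (3 ^ M)%N (x, p)) by [].
apply/AU/nP; split=> [_|i lt_in] /=; first by rewrite twist3.
rewrite shift_pow3 //; apply: leq_trans lt_in _.
exact: (leq_bigmax (cell_transpose p)).
Qed.

End LowerBound.

(** * A continuous coloring with 2k - 1 colors *)

Section UpperBound.
Variable k : nat.
Hypothesis k_gt0 : 0 < k.
Local Notation cell := ('I_k * 'I_k)%type.
Local Notation G := (@twisted_graph k).

Definition palette := discrete_topology 'I_(2 * k - 1).

(** The color of the cell (i, j) over a point with x 0 = a.  The untwisted
    layers 0, 1, 2, 3 are colored as follows, with column colors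
    0, ..., k - 1 and row colors k, ..., 2k - 2 for the rows other than 0.
    Layer 0 has color j in column j.  Layer 1 keeps column colors in row 0 and
    has row colors elsewhere.  Layer 2 has color 0 in the whole of row 0, which
    frees the colors 1, ..., k - 1.  Layer 3 has color i in row i: it is the
    transposed of layer 0, as the twist requires.  Odd layers are transposed
    in the definition. *)
Definition cycle_color (a i j : nat) : nat :=
  match a with
  | 0 => j
  | 1 => if j == 0 then i else k - 1 + j
  | _ => if i == 0 then 0 else k - 1 + i
  end.

Lemma cycle_color_lt a (p : cell) : cycle_color a p.1 p.2 < 2 * k - 1.
Proof.
case: p => -[i ik] [j jk] /=.
by case: a => [|[|a]] /=; [lia| |]; case: ifP; lia.
Qed.

Lemma cycle_color_far a (p q : cell) : far p q ->
  cycle_color a p.1 p.2 <> cycle_color a q.1 q.2.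
Proof.
case: p q => -[i ik] [j jk] [[i' ik'] [j' jk']].
rewrite /far -!val_eqE /= => /andP[/eqP ii' /eqP jj'].
by case: a => [|[|a]] /=; [lia| |]; do 2 case: eqP; lia.
Qed.

Lemma cycle_color_next a (p q : cell) : a < 3 -> far (cell_transpose p) q ->
  cycle_color a p.1 p.2 <> cycle_color (a.+1 %% 3) q.1 q.2.
Proof.
case: p q => -[i ik] [j jk] [[i' ik'] [j' jk']].
rewrite /far -!val_eqE /= => a3 /andP[/eqP ii' /eqP jj'].
by case: a a3 => [|[|[|a]]] //= _; do 2 ?case: eqP; lia.
Qed.

Definition grid_bundle_color (u : grid_bundle k) : palette :=
  Ordinal (cycle_color_lt (u.1 0) u.2).

Lemma grid_bundle_colorE u :
  val (grid_bundle_color u) = cycle_color (val (u.1 0)) u.2.1 u.2.2.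
Proof. by []. Qed.

Lemma shift1_val (x : odometer) : val (shift 1 x 0) = (val (x 0)).+1 %% 3.
Proof. exact: (congr1 (modn^~ 3) (addn1 (x 0))). Qed.

Lemma grid_bundle_color_coloring : coloring G grid_bundle_color.
Proof.
have forward u z p : (z = 0 \/ z = 1)%R -> far u.2 p ->
    grid_bundle_color u <> grid_bundle_color (act z (u.1, p)).
  case: u => x q /= -[->|->] qp.
    by rewrite act0 => /(congr1 val); exact: cycle_color_far.
  have step : val ((act 1 (x, p)).1 0) = (val (x 0)).+1 %% 3.
    by exact: shift1_val.
  move=> /(congr1 val); rewrite !grid_bundle_colorE step.
  apply: cycle_color_next; first exact: ltn_ord.
  by rewrite -(far_twist 1%R) in qp.
move=> u v uv; have := uv => /twisted_graphP[z [p [z1 up vE]]].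
have [z01|z_1] : (z = 0 \/ z = 1)%R \/ z = (-1)%R by lia.
  by rewrite vE; exact: forward.
have uE : u = act 1 (v.1, twist 1 u.2).
  rewrite vE z_1 /act /= -shiftD twistK shift0 .
  by rewrite -surjective_pairing.
rewrite uE => /esym; apply: forward; first by right.
by rewrite vE z_1 /= -(far_twist 1%R) twistK -twistD subrr /= far_sym.
Qed.

Lemma grid_bundle_color_open (A : set palette) :
  open (grid_bundle_color @^-1` A).
Proof.
rewrite openE => u Au; exists 1 => v [uv h].
rewrite /preimage /=; suff <- : grid_bundle_color u = grid_bundle_color v by [].
by apply: val_inj; rewrite /= uv // h.
Qed.

Lemma twisted_graph_borel_colorable (R : realType) :
  borel_colorable R G (2 * k - 1).
Proof.
exists palette; split.
- apply: discrete_polish; apply: finite_set_countable.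
  exact: (@finite_finset 'I_(2 * k - 1)).
- exact: card_ord_set.
- exists grid_bundle_color; split; first exact: grid_bundle_color_coloring.
  by move=> B _; apply: sub_sigma_algebra; exact: grid_bundle_color_open.
Qed.

End UpperBound.

Theorem theorem3 (R : realType) (k : nat) (k_ge3 : (3 <= k)%N) :
  exists (X : topologicalType) (G : set (X * X)%type),
    polish R X /\
    is_graph G /\
    borel G /\
    regular (3 * (k - 1) ^ 2)%N G /\
    (forall C : set X, components setT G C -> component_has_ends G C 2) /\
    chromatic_number G k /\
    baire_chromatic_number R G (2 * k - 1)%N /\
    borel_chromatic_number R G (2 * k - 1)%N.
Proof.
have k_gt0 : 0 < k by apply: leq_trans k_ge3.
have borel_col := twisted_graph_borel_colorable k_gt0 R.
exists (grid_bundle k), (@twisted_graph k).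
split; first exact: grid_bundle_polish.
split; first exact: twisted_graph_is_graph.
split; first exact: twisted_graph_borel.
split; first exact: twisted_graph_regular.
split.
  move=> _ [[x p] _ <-]; rewrite (class_of_thread k_ge3).
  exact: thread_two_ends.
split; first exact: twisted_graph_chromatic.
split; split=> //.
- exact: borel_baire_colorable.
- exact: coloring_lower_bound.
- by move=> m /borel_baire_colorable; exact: coloring_lower_bound.
Qed.
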